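(* The elements $$\lbrace\mathcal W_{-k}\rbrace_{k\in\mathbb N},\quad \lbrace\mathcal W_{k+1}\rbrace_{k\in\mathbb N},\quad \lbrace\mathcal G_{k+1}\rbrace_{k\in\mathbb N},\quad \lbrace\tilde{\mathcal G}_{k+1}\rbrace_{k\in\mathbb N}$$ form a basis for the vector space $\mathcal O$. Moreover, for all $k,\ell\in\mathbb N$, \begin{align*} &[\mathcal W_{-k},\mathcal W_{\ell+1}]=(\tilde{\mathcal G}_{k+\ell+1}-\mathcal G_{k+\ell+1})/2,\\ &[\mathcal W_{-\ell},\mathcal G_{k+1}]=[\tilde{\mathcal G}_{k+1},\mathcal W_{-\ell}]=4\mathcal W_{-k-\ell-1}-4\mathcal W_{k+\ell+1},\\ &[\mathcal G_{k+1},\mathcal W_{\ell+1}]=[\mathcal W_{\ell+1},\tilde{\mathcal G}_{k+1}]=4\mathcal W_{k+\ell+2}-4\mathcal W_{-k-\ell},\\ &[\mathcal W_{-k},\mathcal W_{-\ell}]=0,\qquad [\mathcal W_{k+1},\mathcal W_{\ell+1}]=0,\qquad [\mathcal G_{k+1},\mathcal G_{\ell+1}]=0,\\ &[\mathcal G_{k+1},\tilde{\mathcal G}_{\ell+1}]=0,\qquad [\tilde{\mathcal G}_{k+1},\tilde{\mathcal G}_{\ell+1}]=0. \end{align*}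
   Context: $\mathbb F$ is a field of characteristic zero; all vector spaces and Lie algebras are over $\mathbb F$. $\mathbb N=\{0,1,2,\ldots\}$. $\mathbb F[t,t^{-1}]$ is the algebra of Laurent polynomials. $L(\mathfrak{gl}_2)=\mathfrak{gl}_2\otimes\mathbb F[t,t^{-1}]$ is the loop algebra, with Lie bracket $[u\otimes\varphi,v\otimes\phi]=[u,v]\otimes\varphi\phi$; its elements are viewed as $2\times 2$ matrices with entries in $\mathbb F[t,t^{-1}]$, with bracket $[x,y]=xy-yx$. For $x=\begin{pmatrix} a(t)&b(t)\\ c(t)&d(t)\end{pmatrix}\in L(\mathfrak{gl}_2)$ define $\theta(x)=\begin{pmatrix} d(t^{-1})&c(t^{-1})\\ b(t^{-1})&a(t^{-1})\end{pmatrix}$ and $\varepsilon(x)=a(1)+d(1)\in\mathbb F$. Then $\theta$ is a Lie algebra automorphism of $L(\mathfrak{gl}_2)$ and $\varepsilon:L(\mathfrak{gl}_2)\to\mathbb F$ is a Lie algebra homomorphism ($\mathbb F$ abelian). Let $\mathcal L=\ker\varepsilon$, and let $\mathcal O$ be the Lie algebra of all elements of $\mathcal L$ fixed by $\theta$. For $k\in\mathbb N$ define \begin{align*} &\mathcal W_{-k}=\Bigl(\tfrac{t+t^{-1}}{2}\Bigr)^k\begin{pmatrix}0&1\\1&0\end{pmatrix},\qquad \mathcal W_{k+1}=\Bigl(\tfrac{t+t^{-1}}{2}\Bigr)^k\begin{pmatrix}0&t\\t^{-1}&0\end{pmatrix},\\ &\mathcal G_{k+1}=\Bigl(\tfrac{t+t^{-1}}{2}\Bigr)^k\begin{pmatrix}2t-2&0\\0&2t^{-1}-2\end{pmatrix},\qquad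 \tilde{\mathcal G}_{k+1}=\Bigl(\tfrac{t+t^{-1}}{2}\Bigr)^k\begin{pmatrix}2t^{-1}-2&0\\0&2t-2\end{pmatrix}. \end{align*} *)

(* Defs.v *)
From HB Require Import structures.
From mathcomp Require Import all_boot all_order all_algebra.
From mathcomp Require Import finmap.
From mathcomp Require Import monalg.

Set Implicit Arguments.
Unset Strict Implicit.
Unset Printing Implicit Defensive.

Import GRing.Theory Num.Theory.
Local Open Scope ring_scope.

(* Finitely supported linear combinations. A coefficient family is an element
   of {malg F[I]}, i.e. a finitely supported function I -> F. *)
Section LinearCombination.
Context (F : fieldType) (V : lmodType F) (I : choiceType).
Implicit Types (b : I -> V) (c : {malg F[I]}).

Definition lcomb b c : V := \sum_(i <- msupp c) c@_i *: b i.

Definition is_basis b (S : {pred V}) : Prop :=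
  [/\ forall i, b i \in S,
      forall c, lcomb b c = 0 -> c = 0
    & forall x, x \in S -> exists c, x = lcomb b c].

Lemma lcombEw b (d : {fset I}) c : (msupp c `<=` d)%fset ->
  lcomb b c = \sum_(i <- d) c@_i *: b i.
Proof.
move=> le; rewrite [LHS](big_fset_incl _ le) => //= i _ /mcoeff_outdom ->.
by rewrite scale0r.
Qed.

Lemma lcombU b a i : lcomb b << a *g i >> = a *: b i.
Proof. by rewrite (lcombEw _ msuppU_le) big_seq_fset1 mcoeffUU. Qed.

Lemma lcombP b a c1 c2 : lcomb b (a *: c1 + c2) = a *: lcomb b c1 + lcomb b c2.
Proof.
pose d := (msupp c1 `|` msupp c2)%fset.
have le1 : (msupp c1 `<=` d)%fset by exact: fsubsetUl.
have le2 : (msupp c2 `<=` d)%fset by exact: fsubsetUr.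
have le3 : (msupp (a *: c1 + c2) `<=` d)%fset.
  by apply: fsubset_trans (msuppD_le _ _) _; apply: fsetSU; exact: msuppZ_le.
rewrite (lcombEw _ le1) (lcombEw _ le2) (lcombEw _ le3) scaler_sumr -big_split.
by apply: eq_bigr => i _; rewrite mcoeffD mcoeffZ scalerDl scalerA.
Qed.

HB.instance Definition _ b :=
  GRing.isLinear.Build F {malg F[I]} V *:%R (lcomb b) (lcombP b).

Lemma eq_linear_malg (f g : {linear {malg F[I]} -> V}) :
  (forall i, f << i >> = g << i >>) -> f =1 g.
Proof.
move=> fg c; rewrite [c]monalgE !linear_sum; apply: eq_bigr => i _.
suff -> : << c@_i *g i >> = c@_i *: << i >> by rewrite !linearZ fg.
by apply/malgP => k; rewrite mcoeffZ !mcoeffU mulrnAr mulr1.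
Qed.
End LinearCombination.

(* F[t, t^-1] is the group algebra of the additive group int: the coefficient
   of t ^ k in f is f@_k. The ring structure of monalg requires a monoid
   without nontrivial units, so the convolution product is defined here. The
   operations are locked because unification unfolds those of malg, which is
   very slow. *)
Record laurent (F : fieldType) : predArgType :=
  Laurent { laurent_coef :> {malg F[int]} }.

HB.instance Definition _ F := [isNew for @laurent_coef F].
HB.instance Definition _ F := [Choice of laurent F by <:].

HB.lock Definition laurent_add F (f g : laurent F) : laurent F :=
  Laurent ((f : {malg _[_]}) + (g : {malg _[_]})).
HB.lock Definition laurent_opp F (f : laurent F) : laurent F :=
  Laurent (- (f : {malg _[_]})).
HB.lock Definition laurent_scale (F : fieldType) (a : F) (f : laurent F) :
  laurent F := Laurent (a *: (f : {malg _[_]})).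
HB.lock Definition laurent_mul (F : fieldType) (f g : laurent F) : laurent F :=
  Laurent (\sum_(i <- msupp f) \sum_(j <- msupp g) << f@_i * g@_j *g i + j >>).

Section Laurent.
Context (F : fieldType).
Local Notation L := (laurent F).
Local Notation coef := (@laurent_coef F).
Implicit Types (f g h : L) (i j k : int) (a : F).

Lemma laurent_coef_inj : injective coef.
Proof. by case=> f [g] /= ->. Qed.

Lemma laurentP f g : (forall k, f@_k = g@_k) -> f = g.
Proof. by case: f g => [f] [g] /malgP /= ->. Qed.

Definition laurentE := (laurent_add.unlock, laurent_opp.unlock,
                        laurent_scale.unlock).

Lemma laurent_addA : associative (@laurent_add F).
Proof. by move=> f g h; rewrite !laurentE /= addrA. Qed.
Lemma laurent_addC : commutative (@laurent_add F).
Proof. by move=> f g; rewrite !laurentE /= addrC. Qed.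
Lemma laurent_add0 : left_id (Laurent 0) (@laurent_add F).
Proof. by case=> f; rewrite !laurentE /= add0r. Qed.
Lemma laurent_addN : left_inverse (Laurent 0) (@laurent_opp F) (@laurent_add F).
Proof. by move=> f; rewrite !laurentE /= addNr. Qed.

HB.instance Definition _ := GRing.isZmodule.Build L
  laurent_addA laurent_addC laurent_add0 laurent_addN.

Lemma laurent_scaleA a b f :
  laurent_scale a (laurent_scale b f) = laurent_scale (a * b) f.
Proof. by rewrite !laurentE /= scalerA. Qed.
Lemma laurent_scale1 : left_id 1 (@laurent_scale F).
Proof. by case=> f; rewrite !laurentE /= scale1r. Qed.
Lemma laurent_scaleDr : right_distributive (@laurent_scale F) +%R.
Proof. by move=> a f g; rewrite /GRing.add /= !laurentE /= scalerDr. Qed.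
Lemma laurent_scaleDl f : {morph @laurent_scale F ^~ f : a b / a + b}.
Proof. by move=> a b; rewrite [RHS]/GRing.add /= !laurentE /= scalerDl. Qed.

HB.instance Definition _ := GRing.Zmodule_isLmodule.Build F L
  laurent_scaleA laurent_scale1 laurent_scaleDr laurent_scaleDl.

Lemma laurent_coef_is_linear : linear coef.
Proof. by move=> a f g; rewrite /GRing.add /GRing.scale /= !laurentE. Qed.

HB.instance Definition _ :=
  GRing.isLinear.Build F L {malg F[int]} *:%R coef laurent_coef_is_linear.

Definition lmono k : L := Laurent << k >>.

Lemma laurentE_sum f : f = \sum_(k <- msupp f) f@_k *: lmono k.
Proof.
apply: laurent_coef_inj.
rewrite linear_sum [LHS]monalgE; apply: eq_bigr => k _.
by rewrite linearZ /=; apply/malgP => l; rewrite mcoeffZ !mcoeffU mulrnAr mulr1.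
Qed.

Lemma laurent_mulE f g :
  laurent_mul f g = lcomb (fun i => lcomb (fun j => lmono (i + j)) g) f.
Proof.
apply: laurent_coef_inj.
rewrite laurent_mul.unlock /lcomb linear_sum; apply: eq_bigr => i _ /=.
rewrite linearZ linear_sum /= scaler_sumr; apply: eq_bigr => j _.
rewrite linearZ /= scalerA.
by apply/malgP => l; rewrite mcoeffZ !mcoeffU mulrnAr mulr1.
Qed.

Lemma laurent_mulUU i j : laurent_mul (lmono i) (lmono j) = lmono (i + j).
Proof. by rewrite laurent_mulE !lcombU !scale1r. Qed.

Lemma laurent_mulPl h a f g :
  laurent_mul (a *: f + g) h = a *: laurent_mul f h + laurent_mul g h.
Proof. by rewrite !laurent_mulE linearP lcombP. Qed.

Lemma laurent_mulC : commutative (@laurent_mul F).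
Proof.
move=> f g; rewrite !laurent_mul.unlock; congr Laurent.
rewrite [RHS]exchange_big.
by apply: eq_bigr => i _; apply: eq_bigr => j _; rewrite mulrC addrC.
Qed.

Lemma laurent_mulPr h a f g :
  laurent_mul h (a *: f + g) = a *: laurent_mul h f + laurent_mul h g.
Proof. by rewrite !(laurent_mulC h) laurent_mulPl. Qed.

Lemma laurent_ind (P : L -> Prop) :
  P 0 -> (forall a k f, P f -> P (a *: lmono k + f)) -> forall f, P f.
Proof.
move=> P0 PS f; rewrite [f]laurentE_sum; elim/big_rec: _ => // k g _.
exact: PS.
Qed.

Lemma laurent_mul0l f : laurent_mul 0 f = 0.
Proof. by rewrite laurent_mulE !linear0. Qed.

Lemma laurent_mul0r f : laurent_mul f 0 = 0.
Proof. by rewrite laurent_mulC laurent_mul0l. Qed.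

Lemma laurent_mulA : associative (@laurent_mul F).
Proof.
elim/laurent_ind => [|a i f IHf] g h; first by rewrite !laurent_mul0l.
rewrite (laurent_mulPl _ a _ f) (laurent_mulPl g a _ f) (laurent_mulPl h a).
rewrite -(IHf g h); congr (_ + _); congr (_ *: _) => {f IHf}.
elim/laurent_ind: g h => [|b j g IHg] h.
  by rewrite laurent_mul0l laurent_mul0r laurent_mul0l.
rewrite (laurent_mulPl h b _ g) (laurent_mulPr _ b _ g) (laurent_mulPl h b).
rewrite (laurent_mulPr _ b) -(IHg h); congr (_ + _); congr (_ *: _) => {g IHg}.
elim/laurent_ind: h => [|c k h IHh]; first by rewrite !laurent_mul0r.
rewrite (laurent_mulPr (lmono j) c _ h) (laurent_mulPr _ c _ h).
by rewrite (laurent_mulPr (lmono i) c) IHh !laurent_mulUU addrA.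
Qed.

Lemma laurent_mul1l : left_id (lmono 0) (@laurent_mul F).
Proof.
elim/laurent_ind => [|a i f IHf]; first by rewrite laurent_mul0r.
by rewrite laurent_mulPr laurent_mulUU add0r IHf.
Qed.

Lemma laurent_mulDl : left_distributive (@laurent_mul F) +%R.
Proof. by move=> f g h; have := laurent_mulPl h 1 f g; rewrite !scale1r. Qed.

Lemma lmono0_neq0 : lmono 0 != 0.
Proof.
apply/eqP => /(congr1 (mcoeff (0 : int) \o coef)).
by rewrite /= mcoeffU mcoeff0 eqxx => /eqP; rewrite oner_eq0.
Qed.

HB.instance Definition _ := GRing.Zmodule_isComNzRing.Build L
  laurent_mulA laurent_mulC laurent_mul1l laurent_mulDl lmono0_neq0.

Lemma laurent_scalerAl a f g : a *: (f * g) = (a *: f) * g.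
Proof.
by have := laurent_mulPl g a f 0; rewrite laurent_mul0l !addr0.
Qed.

HB.instance Definition _ :=
  GRing.Lmodule_isLalgebra.Build F L laurent_scalerAl.
HB.instance Definition _ := GRing.Lalgebra_isComAlgebra.Build F L.

Lemma lmono0 : lmono 0 = 1. Proof. by []. Qed.

Lemma lmonoD i j : lmono (i + j) = lmono i * lmono j.
Proof. by rewrite -laurent_mulUU. Qed.

Definition laurent_eval a f : F := \sum_(k <- msupp f) f@_k * a ^ k.

(* f(t) |-> f(t^-1) *)
Definition laurent_inv f : L := \sum_(k <- msupp f) f@_k *: lmono (- k).

Lemma laurent_evalE a f :
  laurent_eval a f = lcomb (V := F^o) (fun k => a ^ k) f.
Proof. by []. Qed.

Lemma laurent_invE f : laurent_inv f = lcomb (fun k => lmono (- k)) f.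
Proof. by []. Qed.

Lemma laurent_inv_mono k : laurent_inv (lmono k) = lmono (- k).
Proof. by rewrite laurent_invE lcombU scale1r. Qed.

Lemma laurent_inv_is_linear : linear laurent_inv.
Proof. by move=> a f g; rewrite !laurent_invE linearP lcombP. Qed.

HB.instance Definition _ :=
  GRing.isLinear.Build F L L *:%R laurent_inv laurent_inv_is_linear.

Lemma laurent_inv_is_monoid_morphism : monoid_morphism laurent_inv.
Proof.
split=> [|f g]; first exact: laurent_inv_mono.
elim/laurent_ind: f => [|a i f IHf]; first by rewrite mul0r raddf0 mul0r.
rewrite mulrDl !linearD /= mulrDl -IHf -scalerAl !linearZ -scalerAl /=.
congr (_ + _); congr (_ *: _) => {f IHf}.
elim/laurent_ind: g => [|b j g IHg]; first by rewrite mulr0 raddf0 mulr0.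
rewrite mulrDr !linearD /= mulrDr -IHg -scalerAr !linearZ -scalerAr /=.
by rewrite -lmonoD !laurent_inv_mono -lmonoD opprD.
Qed.

HB.instance Definition _ := GRing.isMonoidMorphism.Build L L laurent_inv
  laurent_inv_is_monoid_morphism.

Lemma laurent_invK : involutive laurent_inv.
Proof.
elim/laurent_ind => [|a k f IHf]; first by rewrite !raddf0.
by rewrite !linearP /= IHf !laurent_inv_mono opprK.
Qed.

Lemma laurent_eval_mono a k : laurent_eval a (lmono k) = a ^ k.
Proof. by rewrite laurent_evalE lcombU scale1r. Qed.

Lemma laurent_eval_is_linear a : scalar (laurent_eval a).
Proof. by move=> c f g; rewrite !laurent_evalE linearP lcombP. Qed.

HB.instance Definition _ a :=
  GRing.isLinear.Build F L F *%R (laurent_eval a) (laurent_eval_is_linear a).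

Lemma laurent_eval1M f g :
  laurent_eval 1 (f * g) = laurent_eval 1 f * laurent_eval 1 g.
Proof.
elim/laurent_ind: f => [|a i f IHf]; first by rewrite mul0r raddf0 mul0r.
rewrite mulrDl !linearD /= mulrDl -IHf -scalerAl !linearZ -mulrA /=.
congr (_ + _); congr (_ * _) => {f IHf}.
elim/laurent_ind: g => [|b j g IHg]; first by rewrite mulr0 raddf0 mulr0.
rewrite mulrDr !linearD /= mulrDr -IHg -scalerAr !linearZ /= -lmonoD.
by rewrite !laurent_eval_mono !exp1rz mul1r.
Qed.
End Laurent.

(* An alias of 'M[laurent F]_2, because the canonical module structure of the
   latter is over laurent F and not over F. *)
Definition loop_gl2 (F : fieldType) : Type := 'M[laurent F]_2.

Section LoopAlgebra.
Context (F : fieldType).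
Local Notation L := (laurent F).
Local Notation gl2 := (loop_gl2 F).

HB.instance Definition _ := GRing.NzRing.on gl2.

Implicit Types (x y z : gl2) (a : F) (k : nat).

Definition loop_scale a x : gl2 := map_mx (fun f : L => a *: f) x.

Lemma loop_scaleE a x : loop_scale a x = (a%:A : L) *: (x : 'M_2).
Proof. by apply/matrixP => i j; rewrite !mxE -scalerAl mul1r. Qed.

Lemma loop_scalerA a b x : loop_scale a (loop_scale b x) = loop_scale (a * b) x.
Proof. by apply/matrixP => i j; rewrite !mxE scalerA. Qed.
Lemma loop_scale1r : left_id 1 loop_scale.
Proof. by move=> x; apply/matrixP => i j; rewrite !mxE scale1r. Qed.
Lemma loop_scalerDr : right_distributive loop_scale +%R.
Proof. by move=> a x y; apply/matrixP => i j; rewrite !mxE scalerDr. Qed.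
Lemma loop_scalerDl x : {morph loop_scale^~ x : a b / a + b}.
Proof. by move=> a b; apply/matrixP => i j; rewrite !mxE scalerDl. Qed.

HB.instance Definition _ := GRing.Zmodule_isLmodule.Build F gl2
  loop_scalerA loop_scale1r loop_scalerDr loop_scalerDl.

Lemma loop_scalerAl a x y : a *: (x * y) = (a *: x) * y.
Proof. by rewrite [LHS]loop_scaleE [a *: x]loop_scaleE; exact: scalemxAl. Qed.

HB.instance Definition _ :=
  GRing.Lmodule_isLalgebra.Build F gl2 loop_scalerAl.

Lemma loop_scalerAr a x y : a *: (x * y) = x * (a *: y).
Proof. by rewrite [LHS]loop_scaleE [a *: y]loop_scaleE; exact: scalemxAr. Qed.

HB.instance Definition _ := GRing.Lalgebra_isAlgebra.Build F gl2 loop_scalerAr.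

Definition lie x y : gl2 := x * y - y * x.

Definition mat2 (a b c d : L) : gl2 :=
  \matrix_(i, j) if i == 0 then (if j == 0 then a else b)
                 else (if j == 0 then c else d).

Definition theta x : gl2 :=
  mat2 (laurent_inv (x 1 1)) (laurent_inv (x 1 0))
       (laurent_inv (x 0 1)) (laurent_inv (x 0 0)).

Definition eps x : F := laurent_eval 1 (x 0 0) + laurent_eval 1 (x 1 1).

Definition calL : {pred gl2} := [pred x | eps x == 0].
Definition calO : {pred gl2} := [pred x | (x \in calL) && (theta x == x)].

Lemma ord2P (i : 'I_2) : i = 0 \/ i = 1.
Proof. by case: i => -[|[|//]] ?; [left|right]; exact: val_inj. Qed.

Lemma mat2P x y : x 0 0 = y 0 0 -> x 0 1 = y 0 1 ->
  x 1 0 = y 1 0 -> x 1 1 = y 1 1 -> x = y.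
Proof.
by move=> ? ? ? ?; apply/matrixP => i j; case: (ord2P i) (ord2P j) => -> [] ->.
Qed.

Lemma mulgl2E x y i j : (x * y) i j = x i 0 * y 0 j + x i 1 * y 1 j.
Proof.
have e : lift ord0 ord0 = 1 :> 'I_2 by exact: val_inj.
by rewrite mxE big_ord_recl big_ord1 e.
Qed.

Lemma theta_is_linear : linear theta.
Proof. by move=> a x y; apply: mat2P; rewrite !mxE /= linearP. Qed.

HB.instance Definition _ :=
  GRing.isLinear.Build F gl2 gl2 *:%R theta theta_is_linear.

Lemma thetaK : involutive theta.
Proof. by move=> x; apply: mat2P; rewrite !mxE /= laurent_invK. Qed.

Lemma theta_lie x y : theta (lie x y) = lie (theta x) (theta y).
Proof.
have thetaM u v : theta (u * v) = theta u * theta v.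
  by apply: mat2P; rewrite !(mxE, mulgl2E) /= rmorphD !rmorphM addrC.
by rewrite /lie linearB /= !thetaM.
Qed.

Lemma eps_is_linear : scalar eps.
Proof. by move=> a x y; rewrite /eps !mxE !linearP /= mulrDr addrACA. Qed.

HB.instance Definition _ :=
  GRing.isLinear.Build F gl2 F *%R eps eps_is_linear.

Lemma eps_lie x y : eps (lie x y) = 0.
Proof.
apply/eqP; rewrite /lie linearB /= subr_eq0; apply/eqP; rewrite /eps.
rewrite !mulgl2E !linearD /= !laurent_eval1M.
by rewrite [RHS]addrACA !(mulrC (laurent_eval 1 (y _ _))).
Qed.

Lemma calO_lie x y : x \in calO -> y \in calO -> lie x y \in calO.
Proof.
move=> /andP[_ /eqP tx] /andP[_ /eqP ty].
by rewrite !inE eps_lie eqxx theta_lie tx ty eqxx.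
Qed.

Definition t : L := lmono F 1.
Definition tV : L := lmono F (-1).

Lemma t_tV : t * tV = 1. Proof. by rewrite -lmonoD subrr. Qed.

(* ((t + t^-1) / 2) ^ k x, an action of a Laurent polynomial on a matrix *)
Definition upow k x : gl2 := ((2^-1 *: (t + tV)) ^+ k : L) *: (x : 'M[L]_2).

(* All integer indices are used: n = - k and n = k + 1 for k in nat. *)
Definition calW (n : int) : gl2 :=
  if (0 < n)%R then upow `|n|.-1 (mat2 0 t tV 0) else upow `|n| (mat2 0 1 1 0).

(* Here n = k + 1 with k in nat; the value at n = 0 is never used. *)
Definition calG (n : nat) : gl2 :=
  upow n.-1 (mat2 (2 *: t - 2) 0 0 (2 *: tV - 2)).
Definition calGt (n : nat) : gl2 :=
  upow n.-1 (mat2 (2 *: tV - 2) 0 0 (2 *: t - 2)).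

Definition alternating_family (i : (nat + nat) + (nat + nat)) : gl2 :=
  match i with
  | inl (inl k) => calW (- k%:Z)
  | inl (inr k) => calW (k%:Z + 1)
  | inr (inl k) => calG (k + 1)
  | inr (inr k) => calGt (k + 1)
  end.
End LoopAlgebra.

Arguments t {F}.
Arguments tV {F}.
Arguments calO {F}.
Arguments calL {F}.
Notation "[L x , y ]" := (lie x y)
  (at level 0, x, y at level 99, format "[L  x ,  y ]") : ring_scope.

(* Main.v *)
From HB Require Import structures.
Require Import Defs.
From mathcomp Require Import all_boot all_order all_algebra.
From mathcomp Require Import finmap monalg ring.

Import GRing.Theory.
Local Open Scope ring_scope.

(** Let u = (t + t^-1) / 2. The proof rests on one fact: F[t, t^-1] is a free
    module over the polynomial ring F[u], with basis 1, t ([laurent_coordK],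
    [laurent_coord_ev]). It is the quotient of F[u][t] by t^2 - 2 u t + 1, so
    the coordinates of t^n are obtained by iterating the multiplication by t,
    (p, q) |-> (-q, p + 2 u q), or its inverse.

    An element of O is determined by its first row (a, b): invariance under
    theta gives the second row, and eps = 0 reads 2 a(1) = 0. All the matrices
    of the theorem are u^k times one of the four matrices with k = 0, so
    linear combinations of the alternating family are the same thing as
    combinations of these four generators with coefficients in F[u]. The
    entry b is p + q t for unique p, q in F[u], the coefficients of the two
    generators of type W. The entry a is divisible by t - 1. The generators
    of type G contribute 2 (t - 1) and 2 (t^-1 - 1) to it, and expanding their
    combination on 1, t gives the coordinates
    (2 (2 u p' - p - p'), 2 (p - p')). The sum of the two coordinates is
    4 (u - 1) p', so p' is found by dividing by u - 1, which is possible exactly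
    when a(1) = 0, since u = 1 at t = 1. This division is also unique, whence
    linear independence ([poly_comb_inj], [poly_comb_surj]).

    The bracket is F[u]-bilinear, so each bracket formula follows from the
    case k = l = 0, a computation with 2 x 2 matrices. *)

(** * Laurent polynomials as a free module over the symmetric ones *)

Section AlternatingBasis.
Context (F : fieldType).
Local Notation L := (laurent F).
Local Notation gl2 := (loop_gl2 F).
Local Notation PP := ({poly F} * {poly F})%type.
Implicit Types (p q : {poly F}) (f : L) (v : PP) (x y : gl2).

Definition usym : L := 2^-1 *: (t + tV).

Local Notation ev := (horner_alg usym).

(** Multiplication by t and t^-1 in the coordinates (p, q) of p + q t, as
    forced by t^2 = 2 u t - 1 and t^-1 = 2 u - t. *)
Definition mult_t v : PP := (- v.2, v.1 + v.2 * 'X *+ 2).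
Definition mult_tV v : PP := (v.2 + v.1 * 'X *+ 2, - v.1).

Lemma mult_tK : cancel mult_t mult_tV.
Proof. by case=> p q; congr pair => /=; ring. Qed.

Lemma mult_tVK : cancel mult_tV mult_t.
Proof. by case=> p q; congr pair => /=; ring. Qed.

Lemma mult_t_is_linear : linear mult_t.
Proof.
by move=> a [p q] [p' q']; congr pair; rewrite /= -!mul_polyC; ring.
Qed.

Definition mono_coord (n : int) : PP :=
  match n with
  | Posz k => iter k mult_t (1, 0)
  | Negz k => iter k.+1 mult_tV (1, 0)
  end.

Lemma mono_coordS n : mono_coord (n + 1) = mult_t (mono_coord n).
Proof.
case: n => [k|[|k]]; first by rewrite -PoszD addn1.
  by rewrite /= mult_tVK.
have -> : Negz k.+1 + 1 = Negz k by rewrite !NegzE -addn1 PoszD opprD addrNK.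
by rewrite [mono_coord (Negz k.+1)]/= mult_tVK.
Qed.

Definition laurent_coord f : PP := lcomb mono_coord f.

Lemma laurent_coord_is_linear : linear laurent_coord.
Proof. by move=> a f g; rewrite /laurent_coord linearP lcombP. Qed.

HB.instance Definition _ :=
  GRing.isLinear.Build F L PP *:%R laurent_coord laurent_coord_is_linear.

Lemma laurent_coord_mono n : laurent_coord (lmono F n) = mono_coord n.
Proof. by rewrite /laurent_coord lcombU scale1r. Qed.

Lemma laurent_coord1 : laurent_coord 1 = (1, 0).
Proof. exact: laurent_coord_mono. Qed.

Lemma laurent_coordMt f : laurent_coord (t * f) = mult_t (laurent_coord f).
Proof.
elim/laurent_ind: f => [|a n f IHf].
  by rewrite mulr0 linear0; congr pair; rewrite /=; ring.
rewrite mulrDr -scalerAr -lmonoD 2!linearP mult_t_is_linear /= IHf.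
by rewrite [1 + n]addrC !laurent_coord_mono mono_coordS.
Qed.

Lemma laurent_coordMtV f : laurent_coord (tV * f) = mult_tV (laurent_coord f).
Proof. by rewrite -{2}[f]mul1r -t_tV -mulrA laurent_coordMt mult_tK. Qed.

Hypothesis two_neq0 : (2 : F) != 0.

Lemma usymMn2 : usym *+ 2 = t + tV.
Proof. by rewrite /usym -scaler_nat scalerA divff // scale1r. Qed.

Lemma laurent_coordMu f :
  laurent_coord (usym * f)
    = ('X * (laurent_coord f).1, 'X * (laurent_coord f).2).
Proof.
rewrite /usym -scalerAl linearZ mulrDl linearD /=.
rewrite laurent_coordMt laurent_coordMtV.
apply: (scalerI two_neq0); rewrite scalerA divff // scale1r scaler_nat.
by congr pair; rewrite /=; ring.
Qed.

Lemma laurent_coordMev p f :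
  laurent_coord (ev p * f)
    = (p * (laurent_coord f).1, p * (laurent_coord f).2).
Proof.
elim/poly_ind: p f => [|p c IHp] f.
  by rewrite rmorph0 !mul0r linear0.
rewrite rmorphD rmorphM /= horner_algX horner_algC mulrDl linearD /=.
rewrite -mulrA IHp laurent_coordMu /= mulr_algl linearZ /=.
by congr pair; rewrite /= -mul_polyC; ring.
Qed.

(** Independence of 1 and t over F[u]. *)
Lemma laurent_coordK p q : laurent_coord (ev p + ev q * t) = (p, q).
Proof.
rewrite linearD /= -[ev p]mulr1 !laurent_coordMev -[t]mulr1 laurent_coordMt.
by rewrite laurent_coord1; congr pair; rewrite /=; ring.
Qed.

(** 1 and t generate over F[u]: the claim for t^n is equivalent to the claim
    for t^(n+1), by [mult_t], because t is invertible. *)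
Lemma laurent_coord_ev f :
  f = ev (laurent_coord f).1 + ev (laurent_coord f).2 * t.
Proof.
have evMt v : ev (mult_t v).1 + ev (mult_t v).2 * t = t * (ev v.1 + ev v.2 * t).
  rewrite /= rmorphN rmorphD rmorphMn rmorphM /= horner_algX -mulrnAr usymMn2.
  by have /= := t_tV F; move: (t : L) (tV : L) => z zV zzV; ring: zzV.
elim/laurent_ind: f => [|a n f IHf].
  by rewrite linear0 !rmorph0 mul0r addr0.
rewrite linearP /= !linearP /= !mulr_algl mulrDl addrACA -IHf.
rewrite -scalerAl -scalerDr; congr (_ *: _ + _).
rewrite laurent_coord_mono => {a f IHf}.
have e0 : 1 = ev (mono_coord 0).1 + ev (mono_coord 0).2 * t.
  by rewrite /= rmorph1 rmorph0 mul0r addr0.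
have tI : injective ( *%R (t : L)).
  by move=> f g /(congr1 ( *%R tV)); rewrite !mulrA (mulrC tV) t_tV !mul1r.
elim: n => [//|k IHk|k IHk].
  by rewrite -addn1 PoszD mono_coordS evMt -IHk -lmonoD addrC.
apply: tI; rewrite -evMt -mono_coordS -lmonoD addrC.
by rewrite -addn1 PoszD opprD subrK.
Qed.

Lemma laurent_inv_ev p : laurent_inv (ev p) = ev p.
Proof.
elim/poly_ind: p => [|p c IHp]; first by rewrite rmorph0 raddf0.
have inv_u : laurent_inv usym = usym.
  by rewrite /usym linearZ linearD /= !laurent_inv_mono opprK addrC.
rewrite rmorphD rmorphM /= horner_algX horner_algC rmorphD rmorphM /= IHp inv_u.
by rewrite linearZ rmorph1.
Qed.

Lemma laurent_eval1_inv f : laurent_eval 1 (laurent_inv f) = laurent_eval 1 f.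
Proof.
elim/laurent_ind: f => [|a n f IHf]; first by rewrite !raddf0.
by rewrite !linearP /= IHf laurent_inv_mono !laurent_eval_mono !exp1rz.
Qed.

Lemma laurent_eval1_ev p : laurent_eval 1 (ev p) = p.[1].
Proof.
elim/poly_ind: p => [|p c IHp]; first by rewrite rmorph0 raddf0 horner0.
have eval1_1 : laurent_eval 1 (1 : L) = 1 by exact: (laurent_eval_mono 1 0).
rewrite rmorphD rmorphM /= horner_algX horner_algC linearD linearZ /=.
rewrite laurent_eval1M IHp eval1_1.
rewrite hornerMXaddC /usym linearZ linearD /= !laurent_eval_mono !exp1rz.
by rewrite mulVf // !mulr1.
Qed.

(** * The loop algebra as an algebra over the symmetric Laurent polynomials *)

Lemma lieE x y i j :
  lie x y i j = x i 0 * y 0 j + x i 1 * y 1 j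
                - (y i 0 * x 0 j + y i 1 * x 1 j).
Proof. by rewrite -!mulgl2E /lie [LHS]mxE [in X in _ + X]mxE. Qed.

Definition poly_act p x : gl2 := (ev p : L) *: (x : 'M[L]_2).

Lemma poly_actE p x i j : poly_act p x i j = ev p * x i j.
Proof. by rewrite mxE. Qed.

Lemma poly_act_linearr p : linear (poly_act p).
Proof.
by move=> a x y; apply/matrixP => i j; rewrite !mxE mulrDr scalerAr.
Qed.

HB.instance Definition _ p :=
  GRing.isLinear.Build F gl2 gl2 *:%R (poly_act p) (poly_act_linearr p).

(** The action with its arguments exchanged, named so that its linearity in
    the polynomial can be registered. *)
Definition poly_act_on x p : gl2 := poly_act p x.

Lemma poly_act_linearl x : linear (poly_act_on x).
Proof.
move=> a p q; apply/matrixP => i j.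
by rewrite !mxE linearP /= mulr_algl mulrDl scalerAl.
Qed.

HB.instance Definition _ x :=
  GRing.isLinear.Build F {poly F} gl2 *:%R (poly_act_on x) (poly_act_linearl x).

Lemma poly_actA p q x : poly_act p (poly_act q x) = poly_act (p * q) x.
Proof. by rewrite /poly_act rmorphM scalerA. Qed.

Lemma poly_act_Xn k x : poly_act 'X^k x = upow k x.
Proof. by rewrite /poly_act rmorphXn /= horner_algX. Qed.

Lemma lie_poly_act p q x y :
  lie (poly_act p x) (poly_act q y) = poly_act (p * q) (lie x y).
Proof.
by apply/matrixP => i j; rewrite !(poly_actE, lieE) rmorphM /=; ring.
Qed.

Lemma theta_poly_act p x : theta (poly_act p x) = poly_act p (theta x).
Proof. by apply: mat2P; rewrite !mxE /= rmorphM /= laurent_inv_ev. Qed.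

Lemma eps_poly_act p x : eps (poly_act p x) = laurent_eval 1 (ev p) * eps x.
Proof. by rewrite /eps !poly_actE !laurent_eval1M mulrDr. Qed.

Lemma poly_act_calO p x : x \in calO -> poly_act p x \in calO.
Proof.
rewrite !inE eps_poly_act theta_poly_act => /andP[/eqP-> /eqP->].
by rewrite mulr0 !eqxx.
Qed.

Lemma calO_theta x : x \in calO -> theta x = x.
Proof. by case/andP => _ /eqP. Qed.

(** * The four generators and their brackets *)

(** The members W_0, W_1, G_1, G~_1 of the family. The first bit separates the
    antidiagonal matrices from the diagonal ones. *)
Definition generator (s : bool * bool) : gl2 :=
  match s with
  | (false, false) => mat2 0 1 1 0
  | (false, true) => mat2 0 t tV 0
  | (true, false) => mat2 (2 *: t - 2) 0 0 (2 *: tV - 2)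
  | (true, true) => mat2 (2 *: tV - 2) 0 0 (2 *: t - 2)
  end.

Lemma calW_opp k : calW F (- k%:Z) = poly_act 'X^k (generator (false, false)).
Proof. by rewrite poly_act_Xn; case: k. Qed.

Lemma calW_pos k : calW F (k%:Z + 1) = poly_act 'X^k (generator (false, true)).
Proof. by rewrite poly_act_Xn -PoszD addn1. Qed.

Lemma calG_act k : calG F (k + 1) = poly_act 'X^k (generator (true, false)).
Proof. by rewrite poly_act_Xn addn1. Qed.

Lemma calGt_act k : calGt F (k + 1) = poly_act 'X^k (generator (true, true)).
Proof. by rewrite poly_act_Xn addn1. Qed.

Lemma generator_calO s : generator s \in calO.
Proof.
have eps1 n : laurent_eval 1 (lmono F n) = 1.
  by rewrite laurent_eval_mono exp1rz.
have eps2 : laurent_eval 1 (2 : L) = 2 by rewrite raddfMn /= eps1.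
have inv2 : laurent_inv (2 : L) = 2 by rewrite rmorph_nat.
rewrite !inE; apply/andP; split.
  case: s => -[] []; rewrite /eps !mxE /= ?raddf0 ?addr0 //.
    by rewrite !linearB !linearZ /= !eps1 eps2 mulr1 subrr addr0.
  by rewrite !linearB !linearZ /= !eps1 eps2 mulr1 subrr addr0.
apply/eqP; case: s => -[] []; apply: mat2P; rewrite !mxE /= ?raddf0 ?rmorph1 //.
all: by rewrite ?linearB ?linearZ /= ?inv2 ?laurent_inv_mono.
Qed.

Lemma lie_generator_comm s s' :
  s.1 = s'.1 -> s.1 || (s == s') -> lie (generator s) (generator s') = 0.
Proof.
case: s s' => [[] []] [[] []] //= _ _.
all: by apply: mat2P; rewrite !lieE !mxE /=; ring.
Qed.

Lemma lie_W0_W1 :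
  lie (generator (false, false)) (generator (false, true))
    = 2^-1 *: (generator (true, true) - generator (true, false)).
Proof.
apply: (scalerI two_neq0); rewrite scalerA divff // scale1r scaler_nat.
by apply: mat2P; rewrite mulr2n [LHS]mxE !lieE !mxE /= ?scaler_nat; ring.
Qed.

Lemma four_poly_actXE x i j :
  (4 *: poly_act 'X x : gl2) i j = 2 * (t + tV) * x i j.
Proof. by rewrite mxE poly_actE horner_algX -usymMn2 scaler_nat; ring. Qed.

Lemma lie_W0_G1 :
  lie (generator (false, false)) (generator (true, false))
    = 4 *: poly_act 'X (generator (false, false)) - 4 *: generator (false, true).
Proof.
apply: mat2P; rewrite lieE [RHS]mxE four_poly_actXE !mxE /= !scaler_nat.
all: by ring.
Qed.

Lemma lie_Gt1_W0 :
  lie (generator (true, true)) (generator (false, false))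
    = 4 *: poly_act 'X (generator (false, false)) - 4 *: generator (false, true).
Proof.
apply: mat2P; rewrite lieE [RHS]mxE four_poly_actXE !mxE /= !scaler_nat.
all: by ring.
Qed.

Lemma lie_G1_W1 :
  lie (generator (true, false)) (generator (false, true))
    = 4 *: poly_act 'X (generator (false, true)) - 4 *: generator (false, false).
Proof.
apply: mat2P; rewrite lieE [RHS]mxE four_poly_actXE !mxE /= !scaler_nat.
all: by have := t_tV F; move: (t : L) (tV : L) => z zV zzV; ring: zzV.
Qed.

Lemma lie_W1_Gt1 :
  lie (generator (false, true)) (generator (true, true))
    = 4 *: poly_act 'X (generator (false, true)) - 4 *: generator (false, false).
Proof.
apply: mat2P; rewrite lieE [RHS]mxE four_poly_actXE !mxE /= !scaler_nat.
all: by have := t_tV F; move: (t : L) (tV : L) => z zV zzV; ring: zzV.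
Qed.

Lemma poly_act_Xn_4B k x y :
  poly_act 'X^k (4 *: poly_act 'X x - 4 *: y)
    = 4 *: poly_act 'X^(k.+1) x - 4 *: poly_act 'X^k y.
Proof. by rewrite linearB !linearZ /= poly_actA -exprSr. Qed.

(** * The generators form a basis of O over the symmetric polynomials *)

Definition poly_comb (P : bool * bool -> {poly F}) : gl2 :=
  \sum_s poly_act (P s) (generator s).

Lemma big_bool2 (V : nmodType) (g : bool * bool -> V) :
  \sum_s g s = g (true, true) + g (true, false)
               + (g (false, true) + g (false, false)).
Proof.
transitivity (\sum_s g (s.1, s.2)); first by apply: eq_bigr => -[].
by rewrite -(pair_bigA _ (fun a b => g (a, b))) /= big_bool !big_bool.
Qed.

Lemma poly_comb01 P :
  poly_comb P 0 1 = ev (P (false, false)) + ev (P (false, true)) * t.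
Proof.
rewrite /poly_comb big_bool2 mxE [X in X + _]mxE [X in _ + X]mxE.
by rewrite !poly_actE !mxE /=; ring.
Qed.

Lemma poly_comb00 P :
  poly_comb P 0 0
    = ev ((P (true, true) * 'X *+ 2 - P (true, false) - P (true, true)) *+ 2)
      + ev ((P (true, false) - P (true, true)) *+ 2) * t.
Proof.
rewrite /poly_comb big_bool2 mxE [X in X + _]mxE [X in _ + X]mxE.
rewrite !poly_actE !mxE /= !scaler_nat.
rewrite !(rmorphMn, rmorphB, rmorphM) /= horner_algX.
have -> : (tV : L) = usym *+ 2 - t by rewrite usymMn2 addrC addKr.
by ring.
Qed.

Lemma theta_poly_comb P : theta (poly_comb P) = poly_comb P.
Proof.
rewrite /poly_comb linear_sum; apply: eq_bigr => s _ /=.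
by rewrite theta_poly_act (calO_theta _ (generator_calO _)).
Qed.

(** The vanishing of the t-coordinate of the diagonal entry makes the two G
    coefficients equal, and then the other coordinate is 4 (u - 1) times
    either of them. *)
Lemma poly_comb_inj P : poly_comb P = 0 -> P =1 fun=> 0.
Proof.
move=> P0; have /(congr1 laurent_coord) : poly_comb P 0 1 = 0 by rewrite P0 mxE.
rewrite poly_comb01 laurent_coordK linear0 => -[P00 P01].
have /(congr1 laurent_coord) : poly_comb P 0 0 = 0 by rewrite P0 mxE.
rewrite poly_comb00 laurent_coordK linear0 => -[e1 e2].
have inj2 p : p *+ 2 = 0 -> p = 0.
  by move/eqP; rewrite -scaler_nat scaler_eq0 (negPf two_neq0) => /eqP.
move: e2 => /inj2/eqP; rewrite subr_eq0 => /eqP e2.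
have P11 : P (true, true) = 0.
  move: e1; rewrite e2 => /inj2 e1.
  have : (P (true, true) * ('X - 1%:P)) *+ 2 = 0 by rewrite -[RHS]e1; ring.
  by move/inj2/eqP; rewrite mulf_eq0 polyXsubC_eq0 orbF => /eqP.
by move=> [[] []] /=; rewrite ?e2.
Qed.

Lemma poly_comb_surj x : x \in calO -> exists P, x = poly_comb P.
Proof.
move=> xO; have /andP[/eqP ex /eqP tx] := xO.
set pq := laurent_coord (x 0 0).
have ax : x 0 0 = ev pq.1 + ev pq.2 * t by exact: laurent_coord_ev.
have : root (pq.1 + pq.2) 1.
  (* eps x = 0 says that twice the value of x 0 0 at t = 1 vanishes. *)
  rewrite /root hornerD -!laurent_eval1_ev; apply/eqP/(mulfI two_neq0).
  rewrite mulr0 -ex /eps -[in X in _ + laurent_eval 1 X]tx mxE /=.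
  rewrite laurent_eval1_inv ax.
  by rewrite linearD /= laurent_eval1M laurent_eval_mono; ring.
case/factor_theorem => r er.
(* Solution of the two equations given by poly_comb00 for the G coefficients. *)
pose r4 := (4^-1 : F) *: r.
pose P (s : bool * bool) := match s with
  | (false, false) => (laurent_coord (x 0 1)).1
  | (false, true) => (laurent_coord (x 0 1)).2
  | (true, false) => r4 + 2^-1 *: pq.2
  | (true, true) => r4
  end.
exists P.
have half p : (2^-1 *: p) *+ 2 = p.
  by rewrite -scaler_nat scalerA divff // scale1r.
have r4E : r4 *+ 4 = r.
  have four_neq0 : (4 : F) != 0 by rewrite (natrM F 2 2) mulf_neq0.
  by rewrite -scaler_nat scalerA divff // scale1r.
have x00 : x 0 0 = poly_comb P 0 0.
  rewrite poly_comb00 ax /=; congr (ev _ + ev _ * t).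
    have <- : r * ('X - 1%:P) - pq.2 = pq.1 by rewrite -er; ring.
    by rewrite -{1}r4E -{1}[pq.2]half; ring.
  by rewrite -{1}[pq.2]half; ring.
have x01 : x 0 1 = poly_comb P 0 1 by rewrite poly_comb01 -laurent_coord_ev.
by apply: mat2P => //; rewrite -tx -(theta_poly_comb P) !mxE /= ?x00 ?x01.
Qed.

(** * From polynomial coefficients to scalar coefficients *)

Local Notation I := ((nat + nat) + (nat + nat))%type.

Definition index_type (i : I) : bool * bool :=
  match i with
  | inl (inl _) => (false, false)
  | inl (inr _) => (false, true)
  | inr (inl _) => (true, false)
  | inr (inr _) => (true, true)
  end.

Definition index_degree (i : I) : nat :=
  match i with inl (inl k) | inl (inr k) | inr (inl k) | inr (inr k) => k end.

Definition index_of (s : bool * bool) (k : nat) : I :=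
  match s with
  | (false, false) => inl (inl k)
  | (false, true) => inl (inr k)
  | (true, false) => inr (inl k)
  | (true, true) => inr (inr k)
  end.

Lemma index_inj i j :
  index_type i = index_type j -> index_degree i = index_degree j -> i = j.
Proof. by case: i j => -[] m [] [] n //= _ ->. Qed.

Lemma alternating_familyE i :
  alternating_family F i
    = poly_act 'X^(index_degree i) (generator (index_type i)).
Proof.
by case: i => -[] k; rewrite /= (calW_opp, calW_pos, calG_act, calGt_act).
Qed.

(** The polynomial that collects the coefficients of one of the four series. *)
Definition slice (c : {malg F[I]}) s : {poly F} :=
  \sum_(i <- msupp c | index_type i == s) c@_i *: 'X^(index_degree i).

Lemma lcomb_slice c : lcomb (@alternating_family F) c = poly_comb (slice c).
Proof.
rewrite /poly_comb.
under eq_bigr => s _.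
  rewrite -[poly_act _ _]/(poly_act_on (generator s) (slice c s)).
  rewrite linear_sum /= big_mkcond; over.
rewrite exchange_big /=; apply: eq_bigr => i _.
rewrite (bigD1 (index_type i)) //= eqxx big1 ?addr0; last first.
  by move=> s /negPf ne; rewrite eq_sym ne.
by rewrite linearZ /= alternating_familyE.
Qed.

Lemma coef_slice c i : (slice c (index_type i))`_(index_degree i) = c@_i.
Proof.
have other j : j != i ->
    (if index_type j == index_type i
     then (c@_j *: 'X^(index_degree j))`_(index_degree i) else 0) = 0.
  case: ifP => // /eqP tj ji; rewrite coefZ coefXn; case: eqP => [dj|].
    by rewrite (index_inj _ _ tj (esym dj)) eqxx in ji.
  by rewrite mulr0.
rewrite /slice coef_sum big_mkcond /=.
have [ic|ic] := boolP (i \in msupp c); last first.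
  rewrite (mcoeff_outdom ic) big1_seq // => j /andP[_ jc]; apply: other.
  by apply: contraNneq ic => <-.
rewrite (bigD1_seq i) ?fset_uniq //= eqxx coefZ coefXn eqxx mulr1.
by rewrite big1 ?addr0.
Qed.

Lemma poly_comb_lcomb P :
  exists c, poly_comb P = lcomb (@alternating_family F) c.
Proof.
exists (\sum_s \sum_(k < size (P s)) (P s)`_k *: << index_of s k >>).
rewrite linear_sum; apply: eq_bigr => s _.
rewrite -[poly_act _ _]/(poly_act_on (generator s) (P s)).
rewrite -{1}[P s]coefK poly_def !linear_sum.
apply: eq_bigr => k _; rewrite !linearZ /= lcombU scale1r alternating_familyE.
by case: s k => -[] [] k.
Qed.

Lemma alternating_family_basis : is_basis (@alternating_family F) calO.
Proof.
split=> [i|c c0|x xO].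
- by rewrite alternating_familyE poly_act_calO // generator_calO.
- apply/malgP => i; rewrite mcoeff0 -coef_slice.
  by rewrite poly_comb_inj ?coef0 // -lcomb_slice.
- by have [P ->] := poly_comb_surj _ xO; exact: poly_comb_lcomb.
Qed.

End AlternatingBasis.

Theorem lemma4p13 (F : fieldType) (charF0 : [pchar F] =i pred0) :
  is_basis (@alternating_family F) calO /\
  (forall k l : nat,
    [L calW F (- k%:Z), calW F (l%:Z + 1)]
      = 2^-1 *: (calGt F (k + l + 1) - calG F (k + l + 1)) /\
    ([L calW F (- l%:Z), calG F (k + 1)] = [L calGt F (k + 1), calW F (- l%:Z)] /\
     [L calGt F (k + 1), calW F (- l%:Z)]
      = 4 *: calW F (- k%:Z - l%:Z - 1) - 4 *: calW F (k%:Z + l%:Z + 1)) /\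
    ([L calG F (k + 1), calW F (l%:Z + 1)] = [L calW F (l%:Z + 1), calGt F (k + 1)] /\
     [L calW F (l%:Z + 1), calGt F (k + 1)]
      = 4 *: calW F (k%:Z + l%:Z + 2) - 4 *: calW F (- k%:Z - l%:Z)) /\
    [L calW F (- k%:Z), calW F (- l%:Z)] = 0 /\
    [L calW F (k%:Z + 1), calW F (l%:Z + 1)] = 0 /\
    [L calG F (k + 1), calG F (l + 1)] = 0 /\
    [L calG F (k + 1), calGt F (l + 1)] = 0 /\
    [L calGt F (k + 1), calGt F (l + 1)] = 0).
Proof.
have two_neq0 : (2 : F) != 0 by move/pcharf0P: charF0 => ->.
split; first exact: alternating_family_basis.
move=> k l.
(* Bring every index of W to the form - m or m + 1. *)
have -> : - k%:Z - l%:Z - 1 = - (k + l).+1%N%:Z.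
  by rewrite intS PoszD; ring.
have -> : k%:Z + l%:Z + 2 = (k + l).+1%N%:Z + 1.
  by rewrite intS PoszD; ring.
have -> : - k%:Z - l%:Z = - (k + l)%N%:Z by rewrite PoszD opprD.
rewrite -[k%:Z + l%:Z]PoszD !calW_opp !calW_pos !calG_act !calGt_act.
rewrite !lie_poly_act (mulrC 'X^l) -!exprD.
rewrite lie_W0_W1 // lie_W0_G1 // lie_Gt1_W0 // lie_G1_W1 // lie_W1_Gt1 //.
rewrite !lie_generator_comm // !linear0 !poly_act_Xn_4B.
by do !split; rewrite linearZ linearB.
Qed.
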